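(* Let $\sim$ be an $\mathbf L$-equality on a set $X$ and let $M\subseteq L^X$ be a subset containing only $\mathbf L$-sets compatible with $\sim$. Then the restriction of the power relation $\sim^{+}$ to $M$ is an $\mathbf L$-equality on $M$, and it equals the restriction of $\approx^X$ to $M$.
   Context: $\mathbf L=\langle L,\wedge,\vee,\otimes,\to,0,1\rangle$ is a complete residuated lattice ($\langle L,\wedge,\vee,0,1\rangle$ complete lattice, $\langle L,\otimes,1\rangle$ commutative monoid, $a\otimes b\le c$ iff $a\le b\to c$). An $\mathbf L$-set in $X$ is a map $X\to L$, $L^X$ the set of them. $S(A,B)=\bigwedge_{x\in X}(A(x)\to B(x))$ and $A\approx^X B=S(A,B)\wedge S(B,A)$. A binary $\mathbf L$-relation on $X$ is a map $X\times X\to L$; an $\mathbf L$-equality is one that is reflexive ($x\sim x=1$), symmetric, transitive ($(x\sim y)\otimes(y\sim z)\le x\sim z$) and with $x\sim y=1\Rightarrow x=y$. An $\mathbf L$-set $A$ is compatible with $\sim$ if $A(x)\otimes(x\sim x')\le A(x')$ for all $x,x'$. For a binary $\mathbf L$-relation $R$ on $X$ and $A,B\in L^X$: $(R\circ B)(x)=\bigvee_y R(x,y)\otimes B(y)$, $(A\circ R)(y)=\bigvee_x A(x)\otimes R(x,y)$ and $R^+(A,B)=S(A,R\circ B)\wedge S(B,A\circ R)$. *)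

(* Defs.v *)
From HB Require Import structures.
From mathcomp Require Import all_boot all_order.
From mathcomp Require Import boolp classical_sets.

Set Implicit Arguments.
Unset Strict Implicit.
Unset Printing Implicit Defensive.

Import Order.TTheory.
Local Open Scope classical_set_scope.
Local Open Scope order_scope.

(* The constants 0 and 1 of the residuated lattice are [\bot] and [\top]; the
   degenerate case [\bot = \top] is not excluded. *)
HB.mixin Record isCompleteResiduatedLattice (d : Order.disp_t) L
    of Order.TBLattice d L := {
  supremums_neq0 : forall A : set L, supremums A !=set0;
  infimums_neq0 : forall A : set L, infimums A !=set0;
  otimes : L -> L -> L;
  residuum : L -> L -> L;
  otimesA : associative otimes;
  otimesC : commutative otimes;
  otimes1x : left_id \top otimes;
  otimes_residuum : forall a b c : L,
    (otimes a b <= c) = (a <= residuum b c)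
}.

#[short(type="completeResiduatedLatticeType")]
HB.structure Definition CompleteResiduatedLattice (d : Order.disp_t) :=
  { L of isCompleteResiduatedLattice d L & Order.TBLattice d L }.

Declare Scope lset_scope.
Delimit Scope lset_scope with LS.
Local Open Scope lset_scope.

Notation "a ⊗ b" := (otimes a b) (at level 40, left associativity) : lset_scope.
Notation "a ⇒ b" := (residuum a b) (at level 55, right associativity)
  : lset_scope.

Section LSets.
Context {d : Order.disp_t} {L : completeResiduatedLatticeType d}.

(* [supremum] and [infimum] return their first argument on the empty set,
   hence the choice of [\bot] and [\top]. *)
Definition lsup (I : Type) (F : I -> L) : L := supremum \bot (range F).
Definition linf (I : Type) (F : I -> L) : L := infimum \top (range F).

Definition subsethood (X : Type) (A B : X -> L) : L :=
  linf (fun x => A x ⇒ B x).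

Definition lset_eq (X : Type) (A B : X -> L) : L :=
  Order.meet (subsethood A B) (subsethood B A).

Definition is_lequality (X : Type) (R : X -> X -> L) : Prop :=
  [/\ forall x, R x x = \top,
      forall x y, R x y = R y x,
      forall x y z, R x y ⊗ R y z <= R x z
    & forall x y, R x y = \top -> x = y].

Definition compatible (X : Type) (R : X -> X -> L) (A : X -> L) : Prop :=
  forall x x', A x ⊗ R x x' <= A x'.

Definition rel_lset (X : Type) (R : X -> X -> L) (B : X -> L) : X -> L :=
  fun x => lsup (fun y => R x y ⊗ B y).

Definition lset_rel (X : Type) (A : X -> L) (R : X -> X -> L) : X -> L :=
  fun y => lsup (fun x => A x ⊗ R x y).

Definition power_rel (X : Type) (R : X -> X -> L) (A B : X -> L) : L :=
  Order.meet (subsethood A (rel_lset R B)) (subsethood B (lset_rel A R)).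

(* Restriction to the subtype [{x | x \in M}], to which [M] coerces. *)
Definition rel_restr (T : Type) (M : set T) (R : T -> T -> L) : M -> M -> L :=
  fun a b => R (val a) (val b).

End LSets.

Arguments rel_restr {d L T} M R _ _.
Arguments lset_eq {d L X} A B.

(* Main.v *)
(** On compatible [L]-sets the power relation is already the [L]-set equality:
    reflexivity of [~] gives [B <= ~ o B], compatibility gives the converse,
    so [~ o B = B] and likewise [A o ~ = A]. Hence [~^+] agrees on [M] with
    graded mutual inclusion, which is an [L]-equality on any set of
    [L]-sets. *)
Require Import Defs.
From mathcomp Require Import all_boot all_order.
From mathcomp Require Import boolp classical_sets.

Set Implicit Arguments.
Unset Strict Implicit.
Unset Printing Implicit Defensive.

Import Order.TTheory.

Section ResiduatedLattice.
Local Open Scope order_scope.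
Local Open Scope lset_scope.
Context {d : Order.disp_t} {L : completeResiduatedLatticeType d}.
Implicit Types a b c : L.

Lemma otimesx1 a : a ⊗ \top = a.
Proof. by rewrite otimesC otimes1x. Qed.

Lemma le_otimes2r c a b : a <= b -> a ⊗ c <= b ⊗ c.
Proof. by move=> ab; rewrite otimes_residuum (le_trans ab)// -otimes_residuum. Qed.

Lemma le_otimes2 a a' b b' : a <= a' -> b <= b' -> a ⊗ b <= a' ⊗ b'.
Proof.
move=> aa' bb'; apply: (le_trans (le_otimes2r b aa')).
by rewrite otimesC [leRHS]otimesC le_otimes2r.
Qed.

Lemma residuum_mp a b : a ⊗ (a ⇒ b) <= b.
Proof. by rewrite otimesC otimes_residuum. Qed.

Lemma residuum_eq1 a b : (\top <= a ⇒ b) = (a <= b).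
Proof. by rewrite -otimes_residuum otimes1x. Qed.

(** The index [i] makes the range nonempty, which excludes the default of [supremum] on the empty
    set. Completeness excludes the default of [xget]. *)
Lemma lsup_ub (I : Type) (F : I -> L) i : F i <= lsup F.
Proof.
rewrite /lsup /supremum ifF; last by apply/negbTE/set0P; exists (F i), i.
case: xgetP => [s _ [ubs _]|ns]; first by apply: ubs; exists i.
by have [s /ns] := supremums_neq0 (range F).
Qed.

(** Wherever a default value is returned it is [\bot], which lies below [a]; otherwise the value is
    a least upper bound. *)
Lemma lsup_le (I : Type) (F : I -> L) a : (forall i, F i <= a) -> lsup F <= a.
Proof.
move=> Fa; rewrite /lsup /supremum; case: ifP => _; first exact: le0x.
case: xgetP => [s _ [_ lubs]|_]; last exact: le0x.
by apply: lubs => _ [i _ <-].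
Qed.

Lemma linf_lb (I : Type) (F : I -> L) i : linf F <= F i.
Proof.
rewrite /linf /infimum ifF; last by apply/negbTE/set0P; exists (F i), i.
case: xgetP => [s _ [lbs _]|ns]; first by apply: lbs; exists i.
by have [s /ns] := infimums_neq0 (range F).
Qed.

Lemma linf_ge (I : Type) (F : I -> L) a : (forall i, a <= F i) -> a <= linf F.
Proof.
move=> Fa; rewrite /linf /infimum; case: ifP => _; first exact: lex1.
case: xgetP => [s _ [_ glbs]|_]; last exact: lex1.
by apply: glbs => _ [i _ <-].
Qed.

End ResiduatedLattice.

Section LSetTheory.
Local Open Scope order_scope.
Local Open Scope lset_scope.
Context {d : Order.disp_t} {L : completeResiduatedLatticeType d} {X : Type}.
Implicit Types A B C : X -> L.

Lemma subsethood_eq1 A B : subsethood A B = \top <-> forall x, A x <= B x.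
Proof.
split=> [AB x|AB].
  by rewrite -residuum_eq1 -AB; exact: (linf_lb (fun x => A x ⇒ B x)).
by apply/eqP; rewrite -le1x; apply: linf_ge => x; rewrite residuum_eq1.
Qed.

(** By adjunction it suffices to bound [A x ⊗ subsethood A B ⊗ subsethood B C] by [C x] at each [x]:
    two applications of graded modus ponens, through [B x]. *)
Lemma subsethood_trans A B C :
  subsethood A B ⊗ subsethood B C <= subsethood A C.
Proof.
apply: linf_ge => x; rewrite -otimes_residuum otimesC otimesA.
have AB : A x ⊗ subsethood A B <= B x.
  apply: le_trans (residuum_mp (A x) _); apply: le_otimes2 => //.
  exact: (linf_lb (fun x => A x ⇒ B x)).
apply: le_trans (residuum_mp (B x) _); apply: le_otimes2 => //.
exact: (linf_lb (fun x => B x ⇒ C x)).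
Qed.

Lemma lset_eq_lequality : is_lequality (@lset_eq d L X).
Proof.
have refl A : subsethood A A = \top by apply/subsethood_eq1.
split=> [A|A B|A B C|A B].
- by rewrite /lset_eq refl meetxx.
- exact: meetC.
- rewrite lexI (le_trans _ (subsethood_trans A B C))/=.
    (* The reverse inclusion runs from [C] through [B] to [A], so the two factors are swapped
       first. *)
    rewrite otimesC (le_trans _ (subsethood_trans C B A))//.
    by rewrite le_otimes2 ?leIr.
  by rewrite le_otimes2 ?leIl.
(* A meet equal to [\top] forces both degrees of inclusion to be [\top]; pointwise antisymmetry then
   applies. *)
- move=> AB1; have [AB BA] : subsethood A B = \top /\ subsethood B A = \top.
    by split; apply/eqP; rewrite -le1x -AB1 ?leIl ?leIr.
  apply: funext => x; apply: le_anti.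
  by rewrite (proj1 (subsethood_eq1 _ _) AB) (proj1 (subsethood_eq1 _ _) BA).
Qed.

Lemma is_lequality_restr (T : Type) (M : set T) (R : T -> T -> L) :
  is_lequality R -> is_lequality (rel_restr M R).
Proof.
case=> Rr Rs Rt Re; split=> [a|a b|a b c|a b ab].
- exact: Rr.
- exact: Rs.
- exact: Rt.
- exact/val_inj/Re.
Qed.

(** Compatibility bounds every term of the supremum at [y] by [A y], and reflexivity makes the term
    at [x = y] equal to [A y]. *)
Lemma lset_rel_compatible (R : X -> X -> L) A :
  (forall x, R x x = \top) -> compatible R A -> lset_rel A R = A.
Proof.
move=> Rr RA; apply: funext => y; apply: le_anti; apply/andP; split.
  by apply: lsup_le => x; exact: RA.
by rewrite -{1}(otimesx1 (A y)) -(Rr y) (lsup_ub (fun x => A x ⊗ R x y)).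
Qed.

(** Reduces the left composition to the right one, so that [lset_rel_compatible] covers both halves
    of the power relation. *)
Lemma rel_lset_sym (R : X -> X -> L) A :
  (forall x y, R x y = R y x) -> rel_lset R A = lset_rel A R.
Proof.
move=> Rs; apply: funext => x; congr lsup; apply: funext => y.
by rewrite Rs otimesC.
Qed.

Lemma power_rel_compatible (R : X -> X -> L) A B :
    (forall x, R x x = \top) -> (forall x y, R x y = R y x) ->
    compatible R A -> compatible R B ->
  power_rel R A B = lset_eq A B.
Proof.
by move=> Rr Rs RA RB; rewrite /power_rel rel_lset_sym// !lset_rel_compatible.
Qed.

End LSetTheory.

Theorem theorem5 (d : Order.disp_t) (L : completeResiduatedLatticeType d)
    (X : Type) (sim : X -> X -> L) (M : set (X -> L))
    (sim_eq : is_lequality sim)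
    (M_compat : forall A : X -> L, M A -> compatible sim A) :
  is_lequality (rel_restr M (power_rel sim)) /\
  rel_restr M (power_rel sim) = rel_restr M lset_eq.
Proof.
case: sim_eq => simr sims _ _.
(* Rewriting with the second claim turns the first into a statement about [lset_eq] alone. *)
have -> : rel_restr M (power_rel sim) = rel_restr M lset_eq.
  apply: funext => A; apply: funext => B.
  by apply: power_rel_compatible => //; apply/M_compat/set_mem/valP.
by split=> //; exact/is_lequality_restr/lset_eq_lequality.
Qed.
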